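(* Let $\Gamma_1,\Gamma_2\in\mathcal{T}_n$ be two tensors on the same $O(n)$-orbit, and suppose that $\sigma\circ\Gamma_1=\Gamma_2$ with $\sigma\in O(n)$. Let $Q:\mathcal{T}_n\to M^{\mathrm{sym}}_{n\times n}$ be a real symmetric matrix valued covariant. If the eigenvalues of $Q(\Gamma_2)$ are distinct, then $\sigma$ is one of the finite list of $2^n$ orthogonal maps $\rho\in O(n)$ such that $$\rho\, Q(\Gamma_1)\,\rho^t=Q(\Gamma_2).$$
   Context: $\mathcal{T}_n$ is the set of real $n\times n\times n$ tensors $\Gamma=(\Gamma^i_{jk})$ that are trilinear (completely symmetric), i.e. $\Gamma^i_{jk}=\Gamma^i_{kj}=\Gamma^j_{ik}$. The group $O(n)$ acts on $\mathcal{T}_n$ by $(\sigma\circ\Gamma)^i_{jk}=\sum_{i',j',k'}\sigma_{ii'}\sigma_{jj'}\sigma_{kk'}\Gamma^{i'}_{j'k'}$. A polynomial $J:\mathbb{R}^n\times\mathcal{T}_n\to\mathbb{R}$, homogeneous separately in both arguments, is a covariant (under $O(n)$) if $J(x,\Gamma)=J(\sigma x,\sigma\circ\Gamma)$ for every $\sigma\in O(n)$. A real symmetric matrix valued function $Q:\mathcal{T}_n\to M^{\mathrm{sym}}_{n\times n}$ is a covariant if the quadratic form $q(x,\Gamma)=x^tQ(\Gamma)x$ is a covariant. *)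

(* Defs.v *)
From HB Require Import structures.
From mathcomp Require Import all_boot all_order all_algebra.
From mathcomp Require Import reals.
(* Not imported: its notations clash with those of mathcomp-analysis. *)
From mathcomp Require mpoly.

Set Implicit Arguments.
Unset Strict Implicit.
Unset Printing Implicit Defensive.

Import Order.TTheory GRing.Theory Num.Theory.
Local Open Scope ring_scope.

Section SymmetricTensors.
Context {R : realType} {n : nat}.

(* The entry Gamma^i_{jk} is [G i j k]: the upper index selects a matrix. *)
Definition trilinear : {pred {ffun 'I_n -> 'M[R]_n}} :=
  [pred G : {ffun 'I_n -> 'M[R]_n} |
    [forall i, forall j, forall k,
      (G i j k == G i k j) && (G i j k == G j i k)]].

Lemma trilinearP (G : {ffun 'I_n -> 'M[R]_n}) :
  reflect (forall i j k, G i j k = G i k j /\ G i j k = G j i k)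
          (G \in trilinear).
Proof.
apply: (iffP forallP) => [h i j k|h i].
  by move/forallP: (h i) => /(_ j) /forallP /(_ k) /andP[/eqP ? /eqP ?].
by apply/forallP => j; apply/forallP => k; case: (h i j k) => <- <-; rewrite !eqxx.
Qed.

Fact trilinear_submod_closed : submod_closed trilinear.
Proof.
split=> [|a G H /trilinearP hG /trilinearP hH]; apply/trilinearP => i j k.
  by rewrite !ffunE !mxE.
rewrite !ffunE !mxE; have [<- <-] := hG i j k; by have [<- <-] := hH i j k.
Qed.

HB.instance Definition _ :=
  GRing.isSubmodClosed.Build R {ffun 'I_n -> 'M[R]_n} trilinear
    trilinear_submod_closed.

Record symtensor := SymTensor {
  symtensor_val :> {ffun 'I_n -> 'M[R]_n};
  symtensor_valP : symtensor_val \in trilinear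
}.

HB.instance Definition _ := [isSub for symtensor_val].
HB.instance Definition _ := [Choice of symtensor by <:].
HB.instance Definition _ := [SubChoice_isSubLmodule of symtensor by <:].

Definition tensor_act (s : 'M[R]_n) (G : {ffun 'I_n -> 'M[R]_n}) :
    {ffun 'I_n -> 'M[R]_n} :=
  [ffun i => \matrix_(j, k) \sum_(i' < n) \sum_(j' < n) \sum_(k' < n)
    s i i' * s j j' * s k k' * G i' j' k'].

Lemma tensor_act_trilinear (s : 'M[R]_n) (G : symtensor) :
  tensor_act s G \in trilinear.
Proof.
have /trilinearP hG := symtensor_valP G.
apply/trilinearP => i j k; rewrite !ffunE !mxE; split.
  apply: eq_bigr => i' _; rewrite exchange_big; apply: eq_bigr => j' _.
  apply: eq_bigr => k' _; rewrite (hG i' k' j').1; congr (_ * _).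
  exact: mulrAC.
rewrite exchange_big; apply: eq_bigr => i' _; apply: eq_bigr => j' _.
by apply: eq_bigr => k' _; rewrite (hG j' i' k').2 (mulrC (s i _)).
Qed.

Definition symtensor_act (s : 'M[R]_n) (G : symtensor) : symtensor :=
  SymTensor (tensor_act_trilinear s G).

Definition orthogonal_mx (s : 'M[R]_n) : Prop := s *m s^T = 1%:M.

Definition coords (x : 'cV[R]_n) (G : symtensor)
    (c : 'I_n + 'I_n * 'I_n * 'I_n) : R :=
  match c with
  | inl i => x i 0
  | inr (i, j, k) => G i j k
  end.

(* T_n is a linear subspace of the space of all n x n x n tensors, so a
   polynomial function on R^n x T_n is the restriction of a polynomial in the
   n + n^3 ambient coordinates. *)
Definition polynomial_fun (J : 'cV[R]_n -> symtensor -> R) : Prop :=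
  exists p : mpoly.mpoly #|{: 'I_n + 'I_n * 'I_n * 'I_n}| R,
    forall x G, J x G = mpoly.meval (fun c => coords x G (enum_val c)) p.

Definition homogeneous_separately (J : 'cV[R]_n -> symtensor -> R) : Prop :=
  (exists d : nat, forall (t : R) x G, J (t *: x) G = t ^+ d * J x G) /\
  (exists e : nat, forall (t : R) x G, J x (t *: G) = t ^+ e * J x G).

Definition covariant (J : 'cV[R]_n -> symtensor -> R) : Prop :=
  [/\ polynomial_fun J, homogeneous_separately J &
      forall s, orthogonal_mx s -> forall x G, J x G = J (s *m x) (symtensor_act s G)].

Definition matrix_covariant (Q : symtensor -> 'M[R]_n) : Prop :=
  covariant (fun x G => (x^T *m Q G *m x) 0 0).

(* A real symmetric n x n matrix has n real eigenvalues counted with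
   multiplicity; they are distinct when n different scalars are eigenvalues. *)
Definition distinct_eigenvalues (A : 'M[R]_n) : Prop :=
  exists a : seq R, [/\ uniq a, size a = n & {in a, forall l, eigenvalue A l}].

End SymmetricTensors.

Arguments symtensor : clear implicits.

(* Main.v *)
Require Import Defs.
From mathcomp Require Import all_boot all_order all_algebra.
From mathcomp Require Import reals.
Import Order.TTheory GRing.Theory Num.Theory.
Local Open Scope ring_scope.

(** Polarizing the invariance of [x^T Q(Gamma) x] gives
    [sigma Q(Gamma1) sigma^T = Q(Gamma2)].  Let [P] be an orthogonal matrix of
    eigenvectors, [P Q(Gamma2) = D P] with [D] diagonal with distinct entries.
    For orthogonal [rho], the equation [rho Q(Gamma1) rho^T = Q(Gamma2)] says
    that [P rho sigma^T P^T] commutes with [D]; it is then diagonal and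
    orthogonal, that is, one of the [2^n] diagonal matrices of signs. *)

(** Comparing entries in position [(i, j)] gives [M i j * (d 0 i - d 0 j) = 0], and the second
    factor is nonzero off the diagonal. *)
Lemma comm_diag_mx_is_diag (F : idomainType) (n : nat) (d : 'rV[F]_n)
    (M : 'M[F]_n) :
  injective (d 0) -> diag_mx d *m M = M *m diag_mx d -> is_diag_mx M.
Proof.
move=> d_inj comm_dM; apply/is_diag_mxP => i j neq_ij.
have /eqP := congr1 (fun N : 'M_n => N i j) comm_dM.
rewrite mul_diag_mx mul_mx_diag !mxE mulrC -subr_eq0 -mulrBr mulf_eq0 subr_eq0.
by case/orP=> /eqP // /d_inj eq_ij; rewrite eq_ij eqxx in neq_ij.
Qed.

Lemma quadratic_form_inj (F : numFieldType) (n : nat) (A B : 'M[F]_n) :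
  A^T = A -> B^T = B ->
  (forall x : 'cV_n, (x^T *m A *m x) 0 0 = (x^T *m B *m x) 0 0) -> A = B.
Proof.
move=> symA symB eqAB; apply/eqP; rewrite -subr_eq0; apply/eqP.
set M := A - B; have symM : M^T = M by rewrite linearB /= symA symB.
have qM (x : 'cV_n) : (x^T *m M *m x) 0 0 = 0.
  rewrite mulmxBr mulmxBl [LHS]mxE [X in _ + X]mxE eqAB; exact: subrr.
have ME i j : ((delta_mx i 0 : 'cV_n)^T *m M *m (delta_mx j 0 : 'cV_n)) 0 0
    = M i j.
  by rewrite trmx_delta -rowE -colE !mxE.
have addE (X Y : 'M[F]_1) : (X + Y) 0 0 = X 0 0 + Y 0 0 by rewrite mxE.
apply/matrixP=> i j; rewrite [RHS]mxE.
(* Polarization: the form of [M] vanishes at [e_i], [e_j] and [e_i + e_j], which leaves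
   [2 M i j = 0] by symmetry. *)
have := qM (delta_mx i 0 + delta_mx j 0).
rewrite [(_ + _)^T]linearD /= mulmxDl mulmxDr !mulmxDl !addE !qM.
rewrite add0r addr0 !ME -[in M j i]symM [M^T j i]mxE.
by move/eqP; rewrite -mulr2n mulrn_eq0 => /eqP.
Qed.

Lemma mulmx_tr_gt0 (R : realDomainType) (n : nat) (v : 'rV[R]_n) :
  v != 0 -> 0 < (v *m v^T) 0 0.
Proof.
move=> v_neq0; have sq_ge0 (i : 'I_n) : true -> 0 <= v 0 i ^+ 2.
  by rewrite sqr_ge0.
have -> : (v *m v^T) 0 0 = \sum_i v 0 i ^+ 2.
  by rewrite mxE; apply: eq_bigr => i _; rewrite mxE expr2.
rewrite lt_def sumr_ge0 // andbT psumr_eq0 //.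
apply: contraNN v_neq0 => /allP v0; apply/eqP/rowP=> i; rewrite mxE.
by apply/eqP; rewrite -sqrf_eq0; apply: v0; rewrite mem_index_enum.
Qed.

(** Spectral theorem for simple spectrum: eigenvectors for distinct eigenvalues are orthogonal, so
    it is enough to normalize them. *)
Lemma symmetric_mx_diagonalization (R : realType) (n : nat) (A : 'M[R]_n) :
  A^T = A -> distinct_eigenvalues A ->
  exists (P : 'M[R]_n) (d : 'rV[R]_n),
    [/\ orthogonal_mx P, injective (d 0) & P *m A = diag_mx d *m P].
Proof.
move=> symA [a [a_uniq a_size a_eig]].
pose d : 'rV[R]_n := \row_(i < n) a`_i.
have d_inj : injective (d 0).
  move=> i j; rewrite !mxE => /eqP.
  by rewrite nth_uniq ?a_size // => /eqP /val_inj.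
have /fin_all_exists[v vP] (i : 'I_n) :
    exists v : 'rV[R]_n, v *m A = d 0 i *: v /\ v != 0.
  have /a_eig /eigenvalueP[v vA v_neq0] : a`_i \in a.
    by rewrite mem_nth ?a_size.
  by exists v; rewrite vA mxE.
pose V := \matrix_(i < n) v i.
have VA : V *m A = diag_mx d *m V.
  apply/row_matrixP=> i; rewrite !row_mul row_diag_mx -scalemxAl -rowE rowK.
  by case: (vP i).
(* By symmetry of [A], both products of the Gram matrix [V V^T] with [diag_mx d] equal [V A V^T]. *)
have /diag_mxP[m VVm] : is_diag_mx (V *m V^T).
  apply: (@comm_diag_mx_is_diag _ _ d) => //; rewrite mulmxA -VA -!mulmxA.
  by congr (_ *m _); rewrite -[A]symA -trmx_mul VA trmx_mul tr_diag_mx.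
have m_gt0 i : 0 < m 0 i.
  have [_ /mulmx_tr_gt0] := vP i.
  have -> : m 0 i = (V *m V^T) i i by rewrite VVm mxE eqxx.
  congr (0 < _); rewrite [LHS]mxE [RHS]mxE.
  by apply: eq_bigr => j _; rewrite !mxE.
(* [m 0 i] is the squared norm of the eigenvector [v i]; scaling by [c] makes the rows of [V] unit
   vectors. *)
pose c : 'rV[R]_n := \row_i (Num.sqrt (m 0 i))^-1.
exists (diag_mx c *m V), d; split=> //.
  rewrite /orthogonal_mx trmx_mul tr_diag_mx mulmxA -(mulmxA _ V) VVm.
  rewrite !mulmx_diag -[RHS]diag_const_mx; congr diag_mx.
  apply/rowP=> i; rewrite !mxE mulrAC -invfM -expr2 sqr_sqrtr ?ltW //.
  by rewrite mulVf ?gt_eqF.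
by rewrite -mulmxA VA !mulmxA diag_mxC.
Qed.

(** Invariance at the point [s^T x] shows that both sides have the same quadratic form, and a
    symmetric matrix is determined by its form. *)
Lemma matrix_covariant_conj (R : realType) (n : nat)
    (Q : symtensor R n -> 'M[R]_n) :
  (forall G, (Q G)^T = Q G) -> matrix_covariant Q ->
  forall s, orthogonal_mx s ->
  forall G, s *m Q G *m s^T = Q (symtensor_act s G).
Proof.
move=> Qsym [_ _ Qinv] s sO G.
apply: quadratic_form_inj => // [|x].
  by rewrite !trmx_mul trmxK Qsym mulmxA.
have := Qinv s sO (s^T *m x) G.
by rewrite (mulmxA s) sO mul1mx trmx_mul trmxK !mulmxA.
Qed.

Definition sign_mx {R : pzRingType} {n : nat} (e : {ffun 'I_n -> bool}) :
    'M[R]_n :=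
  diag_mx (\row_i (-1) ^+ e i).

Lemma sign_mx_inj (R : numDomainType) (n : nat) : injective (@sign_mx R n).
Proof.
move=> e f /matrixP eq_ef; apply/ffunP=> i.
have := eq_ef i i; rewrite !mxE eqxx !mulr1n.
exact: signr_inj.
Qed.

Lemma sign_mx_orthogonal (R : realType) (n : nat) (e : {ffun 'I_n -> bool}) :
  orthogonal_mx (@sign_mx R n e).
Proof.
rewrite /orthogonal_mx tr_diag_mx mulmx_diag -diag_const_mx; congr diag_mx.
by apply/rowP=> i; rewrite !mxE -expr2 sqrr_sign.
Qed.

Lemma diag_orthogonal_sign (R : realType) (n : nat) (M : 'M[R]_n) :
  is_diag_mx M -> orthogonal_mx M -> exists e, M = sign_mx e.
Proof.
case/diag_mxP=> d ->; rewrite /orthogonal_mx tr_diag_mx mulmx_diag => /matrixP dd.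
(* Orthogonality reads [d 0 i ^+ 2 = 1]; the boolean [true] encodes the entry [-1]. *)
exists [ffun i => d 0 i == -1]; congr diag_mx.
apply/rowP=> i; have := dd i i; rewrite !mxE ffunE eqxx !mulr1n -expr2 => /eqP.
by rewrite sqrf_eq1; have [->|_] := eqVneq (d 0 i) (-1); rewrite ?orbF => // /eqP.
Qed.

Theorem theorem5p4 (R : realType) (n : nat) (Gamma1 Gamma2 : symtensor R n)
    (sigma : 'M[R]_n) (sigmaO : orthogonal_mx sigma)
    (sigmaG : symtensor_act sigma Gamma1 = Gamma2)
    (Q : symtensor R n -> 'M[R]_n)
    (Qsym : forall G : symtensor R n, (Q G)^T = Q G)
    (Qcov : matrix_covariant Q)
    (Qdist : distinct_eigenvalues (Q Gamma2)) :
  exists rhos : seq 'M[R]_n,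
    [/\ uniq rhos,
        size rhos = (2 ^ n)%N,
        (forall rho : 'M[R]_n, rho \in rhos <->
           orthogonal_mx rho /\ rho *m Q Gamma1 *m rho^T = Q Gamma2) &
        sigma \in rhos].
Proof.
have sQ := matrix_covariant_conj _ _ _ Qsym Qcov _ sigmaO Gamma1.
rewrite sigmaG in sQ.
have [P [d [PO d_inj PA]]] := symmetric_mx_diagonalization _ _ _ (Qsym Gamma2) Qdist.
have PO' : P^T *m P = 1%:M := mulmx1C PO.
have sO' : sigma^T *m sigma = 1%:M := mulmx1C sigmaO.
set A := Q Gamma2 in sQ PA *; set B := Q Gamma1 in sQ *.
have AE : A = P^T *m diag_mx d *m P by rewrite -mulmxA -PA mulmxA PO' mul1mx.
have BE : B = sigma^T *m A *m sigma.
  by rewrite -sQ !mulmxA sO' mul1mx -mulmxA sO' mulmx1.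
(* The solution [rho] of [P rho sigma^T P^T = sign_mx e]; recovering [sign_mx e] from it makes [f]
   injective, so the list has exactly [2 ^ n] distinct members. *)
pose f e := P^T *m sign_mx e *m P *m sigma.
have fK e : P *m f e *m sigma^T *m P^T = sign_mx e.
  by rewrite /f !mulmxA PO mul1mx -(mulmxA _ sigma) sigmaO mulmx1 -mulmxA PO mulmx1.
have f_inj : injective f.
  by move=> e e' eq_f; apply: (@sign_mx_inj R); rewrite -!fK eq_f.
have rhosP rho : rho \in [seq f e | e <- enum {ffun 'I_n -> bool}] <->
    orthogonal_mx rho /\ rho *m B *m rho^T = A.
  split=> [/mapP[e _ ->]|[rhoO rhoB]].
    have fO : orthogonal_mx (f e).
      rewrite /orthogonal_mx /f !trmx_mul trmxK !mulmxA -(mulmxA _ sigma) sigmaO.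
      rewrite mulmx1 -(mulmxA _ P) PO mulmx1 -(mulmxA _ (sign_mx e)).
      by rewrite sign_mx_orthogonal mulmx1.
    split=> //.
    (* After cancelling [sigma] and [P], this is the commutation of [sign_mx e] with [diag_mx d]. *)
    have fB : f e *m B = A *m f e.
      rewrite BE AE /f !mulmxA -(mulmxA _ sigma) sigmaO mulmx1.
      rewrite -!(mulmxA _ P P^T) PO !mulmx1; congr (_ *m _ *m _).
      by rewrite -!mulmxA diag_mxC.
    by rewrite fB -mulmxA fO mulmx1.
  pose M := P *m rho *m sigma^T *m P^T.
  have MO : orthogonal_mx M.
    rewrite /orthogonal_mx /M !trmx_mul !trmxK !mulmxA -(mulmxA _ P^T) PO'.
    by rewrite mulmx1 -(mulmxA _ sigma^T) sO' mulmx1 -(mulmxA _ rho) rhoO mulmx1.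
  have rhoBA : rho *m B = A *m rho.
    by rewrite -rhoB -mulmxA (mulmx1C rhoO) mulmx1.
  have Mdiag : is_diag_mx M.
    apply: (comm_diag_mx_is_diag _ _ d) => //.
    (* Moving [diag_mx d] through [M] from either side turns both products into
       [P rho sigma^T A P^T]. *)
    have DP : P^T *m diag_mx d = A *m P^T.
      by rewrite AE -mulmxA PO mulmx1.
    rewrite /M !mulmxA -PA -(mulmxA P A) -rhoBA BE -(mulmxA _ P^T) DP !mulmxA.
    by rewrite -(mulmxA _ sigma) sigmaO mulmx1.
  have [e Me] := diag_orthogonal_sign _ _ _ Mdiag MO.
  apply/mapP; exists e; rewrite ?mem_enum // /f -Me /M !mulmxA PO' mul1mx.
  by rewrite -(mulmxA _ P^T) PO' mulmx1 -mulmxA sO' mulmx1.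
exists [seq f e | e <- enum {ffun 'I_n -> bool}]; split=> //.
- by rewrite map_inj_uniq ?enum_uniq.
- by rewrite size_map -cardE card_ffun card_bool card_ord.
- by apply/rhosP.
Qed.
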